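(* Let $k\ge 2$ and $0\le l\le k$ be integers and let $T$ be a tree of order $n\ge k+1$. Then $$\bar{\varepsilon}_{k,l}(K_{1,n-1})\le \bar{\varepsilon}_{k,l}(T)\le \bar{\varepsilon}_{k,l}(P_n),$$ and both bounds are sharp, where $K_{1,n-1}$ is the star and $P_n$ the path on $n$ vertices.
   Context: For a tree $G$ and $S\subseteq V(G)$, the Steiner distance $d_G(S)$ is the number of edges of the minimal subtree of $G$ containing $S$. For integers $k\ge 2$, $0\le l\le k\le n=|V(G)|$ and an $l$-subset $S\subseteq V(G)$, the Steiner $(k,l)$-eccentricity is $\varepsilon_{k,l}(S;G)=\max\{d_G(S'): S\subseteq S'\subseteq V(G),\ |S'|=k\}$. The average Steiner $(k,l)$-eccentricity is $\bar{\varepsilon}_{k,l}(G)=\binom{n}{l}^{-1}\sum_{S\subseteq V(G),|S|=l}\varepsilon_{k,l}(S;G)$. *)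

(* Defs.v *)
From HB Require Import structures.
From mathcomp Require Import all_boot all_order all_algebra.

Set Implicit Arguments.
Unset Strict Implicit.
Unset Printing Implicit Defensive.

(* The vertices of a graph form an arbitrary subset of the ambient finite type,
   so that subgraphs of a graph are again graphs over the same type. *)
Definition graph_axiom (V : finType) (p : {set V} * {set {set V}}) : bool :=
  [forall e in p.2, (e \subset p.1) && (#|e| == 2)].

Record graph (V : finType) := Graph {
  graph_val : {set V} * {set {set V}};
  graph_valP : graph_axiom graph_val
}.

HB.instance Definition _ (V : finType) := [isSub for @graph_val V].
HB.instance Definition _ (V : finType) := [Equality of graph V by <:].
HB.instance Definition _ (V : finType) := [Choice of graph V by <:].
HB.instance Definition _ (V : finType) := [Countable of graph V by <:].
HB.instance Definition _ (V : finType) := [Finite of graph V by <:].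

Definition verts (V : finType) (G : graph V) : {set V} := (graph_val G).1.
Definition edges (V : finType) (G : graph V) : {set {set V}} := (graph_val G).2.

Definition adj (V : finType) (G : graph V) : rel V :=
  [rel x y | [set x; y] \in edges G].

Definition connected (V : finType) (G : graph V) : bool :=
  (verts G != set0) &&
  [forall x in verts G, forall y in verts G, connect (adj G) x y].

(* The length bound makes the quantifier finitary; it is harmless since the
   vertices of a cycle are pairwise distinct (see acyclicP). *)
Definition acyclic (V : finType) (G : graph V) : bool :=
  [forall m : 'I_#|V|.+1, forall c : m.-tuple V,
     (2 < m) ==> ~~ ucycleb (adj G) c].

Lemma acyclicP (V : finType) (G : graph V) :
  reflect (forall c : seq V, ucycle (adj G) c -> size c <= 2) (acyclic G).
Proof.
apply: (iffP forallP) => [H c uc | H m].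
  rewrite leqNgt; apply/negP => c_gt2.
  have c_lt : size c < #|V|.+1.
    by case/andP: uc => _ /card_uniqP <-; rewrite ltnS max_card.
  have /forallP/(_ (in_tuple c)) := H (Ordinal c_lt).
  by rewrite /= c_gt2 /= => /negP; apply.
apply/forallP => c; apply/implyP => m_gt2; apply/negP => /H.
by rewrite size_tuple leqNgt m_gt2.
Qed.

Definition is_tree (V : finType) (G : graph V) : bool :=
  connected G && acyclic G.

Definition subgraph (V : finType) (H G : graph V) : bool :=
  (verts H \subset verts G) && (edges H \subset edges G).

(* A subtree of G containing S with as few edges as possible.  The default G
   itself satisfies the constraint when G is a tree and S \subset verts G. *)
Definition steiner_tree (V : finType) (G : graph V) (S : {set V}) : graph V :=
  [arg min_(H < G | [&& subgraph H G, is_tree H & S \subset verts H])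
     #|edges H|].

Definition steiner_dist (V : finType) (G : graph V) (S : {set V}) : nat :=
  #|edges (steiner_tree G S)|.

Definition steiner_ecc (V : finType) (k : nat) (G : graph V) (S : {set V}) :
    nat :=
  \max_(S' : {set V} | [&& S \subset S', S' \subset verts G & #|S'| == k])
    steiner_dist G S'.

Definition avg_steiner_ecc (V : finType) (k l : nat) (G : graph V) : rat :=
  ((\sum_(S : {set V} | (S \subset verts G) && (#|S| == l))
      steiner_ecc k G S)%:R / 'C(#|verts G|, l)%:R)%R.

Definition path_edges (n : nat) : {set {set 'I_n}} :=
  [set [set p.1; p.2] | p : 'I_n * 'I_n & p.2 == p.1.+1 :> nat].

Definition star_edges (n : nat) : {set {set 'I_n}} :=
  [set [set p.1; p.2] | p : 'I_n * 'I_n & (p.1 == 0 :> nat) && (0 < p.2)].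

Lemma path_axiom (n : nat) : graph_axiom ([set: 'I_n], path_edges n).
Proof.
apply/forall_inP => e /imsetP[[i j]]; rewrite inE => /= /eqP ij ->.
by rewrite subsetT cards2 -val_eqE /= ij neq_ltn ltnSn.
Qed.

Lemma star_axiom (n : nat) : graph_axiom ([set: 'I_n], star_edges n).
Proof.
apply/forall_inP => e /imsetP[[i j]]; rewrite inE => /= /andP[/eqP i0 j0] ->.
by rewrite subsetT cards2 -val_eqE /= i0 neq_ltn j0.
Qed.

Definition path_graph (n : nat) : graph 'I_n := Graph (path_axiom n).

(* The star K_{1,n-1}, with vertex 0 as its centre. *)
Definition star_graph (n : nat) : graph 'I_n := Graph (star_axiom n).

(* Main.v *)
(* The Steiner distance of S is at most t iff S lies in a connected vertex set
   of size at most t + 1.  Sums of eccentricities are compared layer by layer: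
   it suffices that, for every t, the number of l-sets of eccentricity at most t
   is largest for the star and smallest for the path among trees of order n.

   Star: only t = k - 1 matters.  If l < k, an l-set all of whose k-supersets are
   connected contains every non-leaf c (otherwise the supersets avoiding c yield
   a connected set avoiding c but containing two neighbours of c), so there are
   at most C(n-1, l-1) of them.  If l = k, there are at most C(n-1, k-1)
   connected k-sets, by removing a leaf and Pascal's rule.

   Path: if l <= k - 2, every l-set of the path has eccentricity n - 1.  If
   l = k - 1, the l-sets of the path of eccentricity at most n - 1 - j are those
   avoiding the j vertices at each end; in a tree, remove two leaves j times:
   every vertex is within distance j of the remaining set M, so the l-subsets
   of M have eccentricity at most n - 1 - j.  If l = k, the k-sets of the path
   of diameter at most t are counted by their last element; removing a leaf w
   of a tree loses at least C(t, k-1) sets, those containing w inside a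
   connected set of size t + 1. *)
Require Import Defs.
From mathcomp Require Import all_boot all_order all_algebra.
From mathcomp Require Import zify.

Set Implicit Arguments.
Unset Strict Implicit.
Unset Printing Implicit Defensive.

(** * Sets of given size between two sets *)

Lemma card_between (V : finType) (A B : {set V}) k :
  A \subset B -> #|A| <= k ->
  #|[set S : {set V} | [&& A \subset S, S \subset B & #|S| == k]]| =
  'C(#|B| - #|A|, k - #|A|).
Proof.
move=> AB Ak; have eD : #|B :\: A| = #|B| - #|A| by rewrite cardsD (setIidPr AB).
rewrite -eD -cards_draws.
rewrite -[RHS](@card_in_imset _ _ (fun S => A :|: S)) => [|S S'].
  apply: eq_card => S; rewrite inE; apply/idP/imsetP => [/and3P[AS SB /eqP Sk]|[S']].
    exists (S :\: A); last by rewrite -[LHS](setID S A) (setIidPr AS).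
    by rewrite inE setSD //= cardsD (setIidPr AS) Sk.
  rewrite inE subsetD => /andP[/andP[SB SA] /eqP Sk] ->.
  rewrite subsetUl subUset AB SB cardsU disjoint_setI0 1?disjoint_sym //.
  by rewrite cards0 Sk subn0 subnKC /=.
have key (X : {set V}) : X \subset B :\: A -> X = (A :|: X) :\: A.
  rewrite subsetD => /andP[_ /setDidPl XA].
  by rewrite setDUl setDv set0U XA.
by rewrite !inE => /andP[/key eS _] /andP[/key eS' _] e; rewrite eS eS' e.
Qed.

Lemma set_between (V : finType) (A B : {set V}) k :
  A \subset B -> #|A| <= k <= #|B| ->
  exists S : {set V}, [/\ A \subset S, S \subset B & #|S| = k].
Proof.
move=> AB /andP[Ak kB].
have : 0 < #|[set S : {set V} | [&& A \subset S, S \subset B & #|S| == k]]|.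
  by rewrite card_between // bin_gt0 leq_sub2r.
by case/card_gt0P => S; rewrite inE => /and3P[? ? /eqP]; exists S.
Qed.

(** * Connected vertex sets and the removal of a vertex *)

Section Conn.

Variables (V : finType) (G : graph V).
Implicit Types (X Y W S : {set V}) (x y z w : V).

Lemma adj_sym : symmetric (adj G).
Proof. by move=> x y; rewrite /adj /= setUC. Qed.

Lemma adj_edge x y : adj G x y -> ([set x; y] \subset verts G) && (x != y).
Proof.
move=> xy; have /forall_inP/(_ _ xy)/andP[-> /eqP] := graph_valP G.
by rewrite cards2; case: (x == y).
Qed.

Lemma adj_verts x y : adj G x y -> x \in verts G.
Proof. by case/adj_edge/andP => /subsetP -> //; rewrite !inE eqxx. Qed.

Lemma adj_neq x y : adj G x y -> x != y.
Proof. by case/adj_edge/andP. Qed.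

(* Connectedness of the subgraph induced by [W], expressed by cuts. *)
Definition conn W : bool :=
  [&& W \subset verts G, W != set0 &
   [forall X : {set V}, (X \proper W) && (X != set0) ==>
     [exists x in X, exists y in W :\: X, adj G x y]]].

Lemma connP W :
  reflect [/\ W \subset verts G, W != set0 &
             forall X, X \proper W -> X != set0 ->
               exists x y, [/\ x \in X, y \in W, y \notin X & adj G x y]]
          (conn W).
Proof.
apply: (iffP and3P) => -[WG W0 H]; split=> //.
  move=> X XW X0; have /forallP/(_ X) := H; rewrite XW X0 /=.
  case/exists_inP => x xX /exists_inP[y]; rewrite inE => /andP[yX yW] xy.
  by exists x, y.
apply/forallP => X; apply/implyP => /andP[XW X0].
have [x [y [xX yW yX xy]]] := H X XW X0.
by apply/exists_inP; exists x => //; apply/exists_inP; exists y; rewrite // inE yX.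
Qed.

Lemma conn1 x : x \in verts G -> conn [set x].
Proof.
move=> xG; apply/connP; split; first by rewrite sub1set.
  by apply/set0Pn; exists x; rewrite inE.
by move=> X; rewrite properEneq subset1 => /andP[/negPf-> /= ->].
Qed.

(** A cut that splits [X] or [Y] is crossed by an edge inside that set. A cut that splits neither
    contains or misses each of them entirely, and the common vertex [u] puts both on the same side,
    so the cut would be everything or empty. *)
Lemma connU X Y : conn X -> conn Y -> X :&: Y != set0 -> conn (X :|: Y).
Proof.
move=> /connP[XG X0 cX] /connP[YG Y0 cY] /set0Pn[u]; rewrite inE => /andP[uX uY].
apply/connP; split; first by rewrite subUset XG.
  by apply/set0Pn; exists u; rewrite inE uX.
move=> Z /properP[ZXY [v vXY vZ]] Z0.
have key (A : {set V}) : A \subset X :|: Y -> (forall B : {set V}, B \proper A -> B != set0 ->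
    exists x y, [/\ x \in B, y \in A, y \notin B & adj G x y]) ->
    Z :&: A != set0 -> ~~ (A \subset Z) ->
    exists x y, [/\ x \in Z, y \in X :|: Y, y \notin Z & adj G x y].
  move=> AXY cA ZA0 AZ.
  have pr : Z :&: A \proper A by rewrite properE subsetIr /= subsetI subxx andbT.
  have [x [y []]] := cA _ pr ZA0; rewrite !inE => /andP[xZ xA] yA.
  by rewrite yA andbT => yZ xy; exists x, y; split; rewrite ?(subsetP AXY).
have [ZX|] := boolP ((Z :&: X != set0) && ~~ (X \subset Z)).
  by case/andP: ZX => ? ?; apply: (key X); rewrite ?subsetUl.
have [ZY _|] := boolP ((Z :&: Y != set0) && ~~ (Y \subset Z)).
  by case/andP: ZY => ? ?; apply: (key Y); rewrite ?subsetUr.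
have sub (A : {set V}) : u \in A -> ~~ ((Z :&: A != set0) && ~~ (A \subset Z)) ->
    (u \in Z -> A \subset Z) /\ (u \notin Z -> Z :&: A = set0).
  move=> uA; rewrite negb_and !negbK => /orP[/eqP ZA|AZ]; split=> // uZ.
    by move/setP/(_ u): ZA; rewrite !inE uZ uA.
  by rewrite (subsetP AZ) in uZ.
move=> /(sub _ uY)[Y1 Y2] /(sub _ uX)[X1 X2].
have [uZ|uZ] := boolP (u \in Z).
  by move: vXY; rewrite inE => /orP[/(subsetP (X1 uZ))|/(subsetP (Y1 uZ))]; rewrite (negPf vZ).
by case/negP: Z0; rewrite -(setIidPl ZXY) setIUr X2 // Y2 // setU0.
Qed.

Lemma conn_add X x y : conn X -> y \in X -> adj G x y -> conn (x |: X).
Proof.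
move=> cX yX xy.
have xyc : conn [set x; y].
  apply/connP; split; first by case/adj_edge/andP: xy.
    by apply/set0Pn; exists x; rewrite !inE eqxx.
  move=> Z /properP[Zxy [v vxy vZ]] /set0Pn[z zZ].
  exists z, v; split=> //.
  have := subsetP Zxy _ zZ; move: vxy; rewrite !inE.
  case/orP => /eqP ev /orP[] /eqP ez; subst v z => //; rewrite ?zZ // in vZ *.
  by rewrite adj_sym.
have -> : x |: X = [set x; y] :|: X by rewrite -setUA (setUidPr (_ : [set y] \subset X)) ?sub1set.
by apply: connU => //; apply/set0Pn; exists y; rewrite !inE eqxx orbT.
Qed.

Lemma conn_nbr W x : conn W -> x \in W -> 1 < #|W| ->
  exists y, [/\ y \in W, y != x & adj G x y].
Proof.
move=> /connP[_ _ cW] xW W1; have pr : [set x] \proper W.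
  by rewrite properEcard sub1set xW cards1.
have [|z [y [/set1P-> yW yx xy]]] := cW _ pr; first by apply/set0Pn; exists x; rewrite inE.
by exists y; split => //; rewrite inE in yx.
Qed.

(** A largest connected proper subset of [W] through [u] extends along a crossing edge, and by
    maximality the extension is all of [W]. This is leaf removal in terms of vertex sets, with [u]
    protected. *)
Lemma conn_peel W u : conn W -> u \in W -> 1 < #|W| ->
  exists w, [/\ w \in W, w != u & conn (W :\ w)].
Proof.
move=> cW uW W1; have [WG _ cut] := connP _ cW.
pose P X := [&& u \in X, X \proper W & conn X].
have Pu : P [set u].
  by rewrite /P set11 conn1 ?(subsetP WG) // properEcard sub1set uW cards1 W1.
case: (@arg_maxnP _ [set u] P (fun X => #|X|) Pu) => X /and3P[uX XW cX] maxX.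
have [|x [y [xX yW yX xy]]] := cut _ XW; first by apply/set0Pn; exists u.
have cyX : conn (y |: X) by apply: (conn_add cX xX); rewrite adj_sym.
have eW : y |: X = W.
  apply/eqP; rewrite eqEsubset subUset sub1set yW (proper_sub XW) /=.
  apply/negPn/negP => nW; have /maxX : P (y |: X).
    by rewrite /P !inE uX orbT cyX properE subUset sub1set yW (proper_sub XW) nW.
  by rewrite /= cardsU1 yX /= add1n ltnn.
exists y; split=> //; first by apply: contraNneq yX => ->.
by rewrite -eW setU1K.
Qed.

Lemma conn_shrink W u s : conn W -> u \in W -> 0 < s <= #|W| ->
  exists X, [/\ conn X, u \in X, X \subset W & #|X| = s].
Proof.
move=> + + /andP[s0]; move: {2}(#|W| - s) (erefl (#|W| - s)) => m.
elim: m W => [|m IH] W em cW uW sW; first by exists W; split=> //; lia.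
have [|w [wW wu cWw]] := conn_peel cW uW; first by lia.
have := cardsD1 w W; rewrite wW => eW.
have [|||X [cX uX XW eX]] := IH _ _ cWw; rewrite ?inE ?uW ?(eq_sym u) ?wu //; try lia.
by exists X; split=> //; apply: subset_trans XW (subD1set _ _).
Qed.

(** Each vertex peeled off takes with it at least one edge to the remaining set. *)
Lemma conn_card_edges W : conn W -> #|W| <= #|[set e in edges G | e \subset W]|.+1.
Proof.
elim: {W}#|W|.+1 {-2}W (ltnSn #|W|) => // m IH W Wm cW.
have [W1|W1] := leqP #|W| 1; first exact: leq_trans W1 _.
have [_ /set0Pn[u uW] _] := connP _ cW.
have [w [wW wu cWw]] := conn_peel cW uW W1.
have [y [yW yw wy]] := conn_nbr cW wW W1.
have := cardsD1 w W; rewrite wW add1n => eW; rewrite eW ltnS.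
apply: leq_trans (IH _ _ cWw) _; first by rewrite eW in Wm.
apply: proper_card.
apply/properP; split; first apply/subsetP => e; rewrite ?inE.
  by case/andP=> -> /subset_trans; apply; apply: subD1set.
exists [set w; y]; rewrite !inE ?subUset !sub1set ?wW ?yW ?andbT //.
by rewrite !inE eqxx andbF.
Qed.

Lemma conn_connect W x y : conn W -> x \in W -> y \in W ->
  connect [rel a b | [&& adj G a b, a \in W & b \in W]] x y.
Proof.
move=> /connP[_ _ cW] xW yW; set e := [rel a b | _].
pose X := [set z in W | connect e x z].
have [/eqP XW|XW] := boolP (X == W); first by move: yW; rewrite -XW inE => /andP[].
have [||a [b []]] := cW X.
- by rewrite properEneq XW; apply/subsetP => z; rewrite inE => /andP[].
- by apply/set0Pn; exists x; rewrite inE xW connect0.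
rewrite !inE => /andP[aW xa] bW + ab; case/negP; rewrite bW (connect_trans xa) //.
by apply: connect1; rewrite /= ab aW bW.
Qed.

Lemma connected_conn : connected G = conn (verts G).
Proof.
apply/andP/idP => [[G0 /forall_inP cG]|cG].
  apply/connP; split=> // X /properP[XG [y yG yX]] /set0Pn[x xX].
  have /forall_inP/(_ y yG) cxy := cG x (subsetP XG x xX).
  have [|nex] := boolP [exists a in X, [exists b, (b \notin X) && adj G a b]].
    case/exists_inP => a aX /existsP[b /andP[bX ab]]; exists a, b; split=> //.
    by rewrite adj_sym in ab; apply: adj_verts ab.
  (* Without a crossing edge [X] would be closed under adjacency, hence would contain everything
     reachable from [x], including [y]. *)
  have clX : closed (adj G) [in X].
    apply: (intro_closed (sym_connect_sym adj_sym)) => a b /= ab aX; apply: contraNT nex => bX.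
    by apply/exists_inP; exists a => //; apply/existsP; exists b; rewrite bX.
  by rewrite -(closed_connect clX cxy) xX in yX.
split; first by case/connP: cG.
apply/forall_inP => x xG; apply/forall_inP => y yG.
apply: connect_sub (conn_connect cG xG yG) => a b /= /andP[ab _].
exact: connect1.
Qed.

End Conn.

(** * Steiner distance through connected sets; acyclicity *)

Section Steiner.

Variable V : finType.
Implicit Types (G H T : graph V) (W X S : {set V}).

Lemma conn_subgraph H G W : subgraph H G -> conn H W -> conn G W.
Proof.
case/andP=> vHG eHG /connP[WH W0 cW]; apply/connP; split=> //.
  exact: subset_trans vHG.
move=> X XW /(cW X XW)[x [y [xX yW yX xy]]]; exists x, y; split=> //.
exact: (subsetP eHG).
Qed.

(** The peeled vertices are put back one at a time, each with a single edge. When [G] is a tree, [H]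
    inherits acyclicity and competes with the Steiner tree. *)
Lemma conn_spanning G W : conn G W ->
  exists H, [/\ subgraph H G, connected H, verts H = W & #|edges H| < #|W|].
Proof.
elim: {W}#|W|.+1 {-2}W (ltnSn #|W|) => // m IH W Wm cW.
have [WG W0 _] := connP _ _ cW; have [u uW] := set0Pn _ W0.
have [W1|W1] := leqP #|W| 1.
  have eW : W = [set u].
    by apply/esym/eqP; rewrite eqEcard sub1set uW cards1.
  have ax : graph_axiom (W, set0 : {set {set V}}).
    by apply/forall_inP => e; rewrite inE.
  have gH : subgraph (Graph ax) G by rewrite /subgraph WG sub0set.
  exists (Graph ax); split=> //; last by rewrite cards0 card_gt0.
  have : conn (Graph ax) [set u] by rewrite conn1.
  by rewrite -eW connected_conn.
have [w [wW wu cWw]] := conn_peel cW uW W1.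
have [y [yW yw wy]] := conn_nbr cW wW W1.
have := cardsD1 w W; rewrite wW add1n => eW.
have [|H [/andP[vHG eHG] cH vH eH]] := IH _ _ cWw; first by rewrite eW in Wm.
have ax : graph_axiom (W, [set w; y] |: edges H).
  apply/forall_inP => e; rewrite in_setU1 => /predU1P[->|eH'].
    by rewrite /= subUset !sub1set wW yW cards2 (eq_sym w) yw.
  have /forall_inP/(_ _ eH')/andP[eV ->] := graph_valP H.
  by rewrite andbT /=; move: eV; rewrite -/(verts H) vH => /subset_trans; apply; apply: subD1set.
have sH : subgraph H (Graph ax).
  by rewrite /subgraph vH subD1set subsetUr.
exists (Graph ax); split=> //.
- by rewrite /subgraph WG /edges /= subUset eHG andbT sub1set; apply: wy.
- suff: conn (Graph ax) (w |: W :\ w) by rewrite setD1K // connected_conn.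
  apply: (@conn_add _ _ _ _ y).
  + by apply: conn_subgraph sH _; rewrite -vH -connected_conn.
  + by rewrite !inE yw.
  + exact: setU11.
- by rewrite eW ltnS /edges /= cardsU1; apply: leq_trans eH; rewrite -add1n leq_add2r leq_b1.
Qed.

Lemma acyclic_subgraph H G : subgraph H G -> acyclic G -> acyclic H.
Proof.
case/andP=> _ eHG /acyclicP aG; apply/acyclicP => c /andP[cH uc].
apply: aG; rewrite /ucycle uc andbT; apply: sub_cycle cH => x y.
exact: (subsetP eHG).
Qed.

Lemma tree_conn T : is_tree T -> conn T (verts T).
Proof. by case/andP; rewrite connected_conn. Qed.

(** In one direction the vertex set of a minimal subtree serves as [X]; in the other, a spanning
    subtree of [X] has fewer than [#|X|] edges and bounds the minimum. From here on distances are
    handled through connected sets only. *)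
Lemma steiner_dist_leP T S t : is_tree T -> S \subset verts T ->
  reflect (exists X, [/\ conn T X, S \subset X & #|X| <= t.+1])
          (steiner_dist T S <= t).
Proof.
move=> tT ST; rewrite /steiner_dist /steiner_tree.
case: arg_minnP => [|H /and3P[HT tH SH] minH].
  by rewrite /subgraph !subxx tT.
apply: (iffP idP) => [Ht|[X [cX SX Xt]]].
  exists (verts H); split=> //; first exact: conn_subgraph (tree_conn tH).
  apply: leq_trans (conn_card_edges (tree_conn tH)) _; rewrite ltnS.
  apply: leq_trans Ht; apply: subset_leq_card.
  by apply/subsetP => e; rewrite inE => /andP[].
have [K [KT cK vK eK]] := conn_spanning cX.
rewrite -ltnS; apply: leq_trans Xt; apply: leq_ltn_trans eK; apply: minH.
rewrite KT /is_tree cK vK SX andbT /=; apply: acyclic_subgraph KT _.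
by case/andP: tT.
Qed.

(** A simple path from [a] to [b] inside [X], closed up through [w], is a cycle of more than two
    vertices unless the path is trivial. *)
Lemma acyclic_nbr_inj G X w a b : acyclic G -> conn G X -> w \notin X ->
  a \in X -> b \in X -> adj G w a -> adj G w b -> a = b.
Proof.
move=> /acyclicP aG cX wX aX bX wa wb.
have /connectP[p] := conn_connect cX aX bX.
case/shortenP => {}p pP up _ lp.
have [pG pX] : path (adj G) a p /\ all [in X] p.
  elim: p (a) pP {up lp} => //= z p IH c /andP[/and3P[-> _ zX] /IH[-> ->]].
  by rewrite zX.
have: ucycle (adj G) [:: w, a & p].
  rewrite /ucycle /= wa rcons_path pG -lp adj_sym wb /=.
  have -> : w \notin a :: p.
    apply: contra wX; rewrite inE => /predU1P[->//|].
    exact: (allP pX).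
  exact: up.
by move/aG; case: p lp {pP up pG pX} => // ->.
Qed.

(** A connected [k]-set through the peeled vertex [w] has at least two elements, so it contains [y],
    the only neighbour of [w] in [W]; this leaves [k - 2] elements to choose. The sets avoiding [w]
    are counted by induction, and Pascal's rule adds the two counts. *)
Lemma conn_acyclic_card G W k : acyclic G -> conn G W -> 1 < k ->
  #|[set S : {set V} | [&& S \subset W, #|S| == k & conn G S]]| <=
  'C(#|W|.-1, k.-1).
Proof.
move=> aG + k1; elim: {W}#|W|.+1 {-2}W (ltnSn #|W|) => // m IH W Wm cW.
have [_ /set0Pn[u uW] _] := connP _ _ cW.
have [W1|W1] := leqP #|W| 1.
  rewrite (_ : [set _ | _] = set0) ?cards0 //; apply/setP => S; rewrite !inE.
  apply/and3P => -[/subset_leq_card SW /eqP Sk _]; lia.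
have [w [wW wu cWw]] := conn_peel cW uW W1.
have [y [yW yw wy]] := conn_nbr cW wW W1.
have := cardsD1 w W; rewrite wW add1n => eW.
have := IH _ _ cWw; rewrite -ltnS -eW => /(_ Wm) le1.
have le2 : #|[set S : {set V} | [&& [set w; y] \subset S, S \subset W & #|S| == k]]|
           <= 'C(#|W|.-2, k.-2).
  rewrite card_between ?cards2 ?(eq_sym w) ?yw ?subn2 //.
  by rewrite subUset !sub1set wW.
have -> : 'C(#|W|.-1, k.-1) = 'C(#|W :\ w|.-1, k.-1) + 'C(#|W|.-2, k.-2).
  case: k k1 {IH le1 le2} => [|[|k]] // _; rewrite eW /=.
  have := leq_ltn_trans (ltn0Sn _) W1; move: W1; rewrite eW ltnS.
  by case: #|W :\ w| => // c _ _; rewrite binS.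
apply: leq_trans (leq_add le1 le2); apply: leq_trans (leq_card_setU _ _).
apply: subset_leq_card; apply/subsetP => S; rewrite !inE => /and3P[SW Sk cS].
rewrite SW Sk cS andbT /= subsetD1 SW /=.
have [wS|//] := boolP (w \in S); rewrite subUset !sub1set wS /=.
have [|z [zS zw wz]] := conn_nbr cS wS; first by rewrite (eqP Sk).
suff -> : y = z by rewrite zS.
apply: (acyclic_nbr_inj aG cWw _ _ _ wy wz); first by rewrite !inE eqxx.
  by rewrite !inE yw yW.
by rewrite !inE zw (subsetP SW).
Qed.

End Steiner.

(** * Non-leaves and repeated removal of two vertices *)

Section Peeling.

Variables (V : finType) (G : graph V).
Implicit Types (W X M S : {set V}).

(** An edge that leaves the end set of another edge meets it in a vertex [c] with two neighbours.
    This supplies the non-leaf for the star bound. *)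
Lemma conn_branch W : conn G W -> 2 < #|W| ->
  exists c a b, [/\ c \in W, a != b, adj G c a & adj G c b].
Proof.
move=> cW W2; have [_ /set0Pn[x xW] cut] := connP _ _ cW.
have [|y [yW yx xy]] := conn_nbr cW xW; first exact: ltnW.
have [||u [z [uxy zW zxy uz]]] := cut [set x; y].
- by rewrite properEcard subUset !sub1set xW yW cards2 (leq_ltn_trans _ W2) // ltnS leq_b1.
- by apply/set0Pn; exists x; rewrite set21.
move: zxy; rewrite !inE negb_or => /andP[zx zy].
case/set2P: uxy uz => -> uz; first by exists x, y, z; rewrite eq_sym zy.
by exists y, x, z; rewrite eq_sym zx adj_sym xy.
Qed.

Lemma conn_peel_layers W j : conn G W -> j.*2 < #|W| ->
  exists M, [/\ conn G M, M \subset W, #|M| = #|W| - j.*2 &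
    forall x, x \in W -> exists p, [/\ path (adj G) x p, last x p \in M & size p <= j]].
Proof.
move=> cW; elim: j => [|j IH] Wj.
  by exists W; rewrite subn0; split=> // x xW; exists [::].
rewrite doubleS in Wj *.
have [|M [cM MW eM rM]] := IH; first by rewrite ltnW // ltnW.
have M2 : 2 < #|M| by rewrite eM ltn_subRL addn2.
have [_ /set0Pn[u uM] _] := connP _ _ cM.
have [|v [vM vu cMv]] := conn_peel cM uM; first exact: ltnW.
have [|y [yM yv vy]] := conn_nbr cM vM; first exact: ltnW.
have yMv : y \in M :\ v by rewrite !inE yv.
have := cardsD1 v M; rewrite vM add1n => eMv.
have Mv1 : 1 < #|M :\ v| by rewrite eMv in M2.
(* Protecting [y] while [w] is removed leaves [v] a neighbour in the remaining set; [w] has its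
   neighbour [z] there. So a path that ended in [v] or [w] needs one more step. *)
have [w [wMv wy cMw]] := conn_peel cMv yMv Mv1.
have [z [zMv zw wz]] := conn_nbr cMv wMv Mv1.
have := cardsD1 w (M :\ v); rewrite wMv add1n => eMw.
exists (M :\ v :\ w); split=> //.
  by apply: subset_trans MW; rewrite (subset_trans (subD1set _ _)) ?subD1set.
  by rewrite -addn2 subnDA -eM eMv eMw subn2.
move=> x /rM[p [xp pM pj]].
have [|lM] := boolP (last x p \in M :\ v :\ w).
  by exists p; split=> //; apply: leqW.
have [b [ab bM]] : exists b, adj G (last x p) b /\ b \in M :\ v :\ w.
  have [e|ne] := eqVneq (last x p) v.
    by exists y; rewrite e !in_setD1 eq_sym wy yv.
  have e : last x p = w.
    by apply/eqP; move: lM; rewrite !in_setD1 ne pM !andbT negbK.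
  by exists z; rewrite e in_setD1 zw.
by exists (rcons p b); rewrite rcons_path xp last_rcons size_rcons.
Qed.

Lemma conn_path M x p : conn G M -> path (adj G) x p -> last x p \in M ->
  exists X, [/\ conn G X, M \subset X, x \in X & #|X| <= #|M| + size p].
Proof.
move=> cM; elim: p x => [|y p IH] x /=.
  by exists M; rewrite addn0.
case/andP=> xy /IH{}IH /IH[X [cX MX yX eX]]; exists (x |: X); split.
- exact: conn_add yX xy.
- exact: subset_trans MX (subsetUr _ _).
- exact: setU11.
- by rewrite cardsU1 addnS (leq_trans (leq_add (leq_b1 _) eX)).
Qed.

End Peeling.

(** * Comparing averages layer by layer *)

Section Average.

(** A natural number is the number of [t] below it, so a sum of values is the sum over [t] of the
    number of indices whose value exceeds [t]. The common bound [N] gives both sums the same range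
    of [t]. *)
Lemma leq_sum_count (I J : finType) (P : pred I) (Q : pred J)
    (f : I -> nat) (g : J -> nat) :
  #|P| = #|Q| ->
  (forall t, #|[set i | P i & f i <= t]| <= #|[set j | Q j & g j <= t]|) ->
  \sum_(j | Q j) g j <= \sum_(i | P i) f i.
Proof.
move=> PQ fg; pose N := \max_i f i + \max_j g j.
have layer (K : finType) (R : pred K) (h : K -> nat) : (forall x, h x <= N) ->
    \sum_(x | R x) h x = \sum_(t < N) (#|R| - #|[set x | R x & h x <= t]|).
  move=> hN; transitivity (\sum_(x | R x) \sum_(t < N) (t < h x)).
    apply: eq_bigr => x _.
    rewrite -(big_mkord predT (fun t => (t < h x) : nat)) /=.
    rewrite (big_cat_nat _ (hN x)) //= big_nat_cond.
    rewrite (eq_bigr (fun=> 1)) => [|t /andP[/andP[_ ->]] //].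
    rewrite -big_nat_cond sum_nat_const_nat subn0 muln1.
    rewrite big_nat_cond big1 ?addn0 // => t /andP[/andP[ht _] _].
    by rewrite ltnNge ht.
  rewrite exchange_big; apply: eq_bigr => t _ /=.
  rewrite -big_mkcondr sum1_card.
  rewrite -[#|R|](cardID [pred x | h x <= t]).
  have -> : #|[set x | R x & h x <= t]| = #|[predI R & [pred x | h x <= t]]|.
    by apply: eq_card => x; rewrite !inE.
  rewrite addKn; apply: eq_card => x; rewrite !inE /in_mem /=.
  by rewrite ltnNge andbC.
rewrite (layer _ P) => [|i]; first rewrite (layer _ Q) => [|j].
- by apply: leq_sum => t _; rewrite PQ leq_sub2l.
- by rewrite (leq_trans (leq_bigmax j)) ?leq_addl.
- by rewrite (leq_trans (leq_bigmax i)) ?leq_addr.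
Qed.

Variables (k l : nat).

Definition ecc_count (V : finType) (G : graph V) (t : nat) : nat :=
  #|[set S : {set V} | (S \subset verts G) && (#|S| == l) & steiner_ecc k G S <= t]|.

Lemma leq_avg_steiner_ecc (V U : finType) (G : graph V) (H : graph U) :
  #|verts G| = #|verts H| -> (forall t, ecc_count G t <= ecc_count H t) ->
  (avg_steiner_ecc k l H <= avg_steiner_ecc k l G)%R.
Proof.
move=> GH le; rewrite /avg_steiner_ecc GH; apply: Num.Theory.ler_wpM2r.
  by rewrite Num.Theory.invr_ge0 Num.Theory.ler0n.
rewrite Num.Theory.ler_nat; apply: leq_sum_count; last exact: le.
have card_sets (W : finType) (K : graph W) :
    #|[pred S : {set W} | (S \subset verts K) && (#|S| == l)]| = 'C(#|verts K|, l).
  by rewrite -cards_draws; apply: eq_card => S; rewrite !inE.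
by rewrite [LHS]card_sets [RHS]card_sets GH.
Qed.

Lemma steiner_ecc_leP (V : finType) (G : graph V) (S : {set V}) t :
  reflect (forall S' : {set V}, S \subset S' -> S' \subset verts G -> #|S'| = k ->
             steiner_dist G S' <= t)
          (steiner_ecc k G S <= t).
Proof.
rewrite /steiner_ecc; apply: (iffP (bigmax_leqP _ _ _)) => H S'.
  by move=> SS' S'G Sk; apply: H; rewrite SS' S'G Sk eqxx.
by case/and3P => ? ? /eqP; apply: H.
Qed.

Lemma ecc_count_le (V : finType) (G : graph V) t : ecc_count G t <= 'C(#|verts G|, l).
Proof.
rewrite -cards_draws; apply: subset_leq_card; apply/subsetP => S.
by rewrite !inE => /andP[].
Qed.

Lemma ecc_count_full (V : finType) (G : graph V) t :
  (forall S : {set V}, S \subset verts G -> #|S| = k -> steiner_dist G S <= t) ->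
  ecc_count G t = 'C(#|verts G|, l).
Proof.
move=> H; rewrite -cards_draws; apply: eq_card => S; rewrite !inE.
suff -> : steiner_ecc k G S <= t by rewrite andbT.
by apply/steiner_ecc_leP => S' _; apply: H.
Qed.

End Average.

Lemma set2_inj (T : finType) (x y a b : T) : [set x; y] = [set a; b] ->
  x = a /\ y = b \/ x = b /\ y = a.
Proof.
move=> e; have : x \in [set a; b] by rewrite -e set21.
have : y \in [set a; b] by rewrite -e set22.
have : a \in [set x; y] by rewrite e set21.
have : b \in [set x; y] by rewrite e set22.
by move=> /set2P[] ? /set2P[] ? /set2P[] ? /set2P[] ?; subst; auto.
Qed.

(** * The path and the star as trees *)

Section PathStar.

Variable n : nat.
Implicit Types (X S : {set 'I_n}).

Lemma adj_path (i j : 'I_n) :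
  adj (path_graph n) i j = (j == i.+1 :> nat) || (i == j.+1 :> nat).
Proof.
apply/imsetP/orP => [[[a b]]|[ij|ij]]; last 2 first.
- by exists (i, j); rewrite ?inE.
- by exists (j, i); rewrite ?inE // setUC.
by rewrite inE => /= ab /set2_inj[[-> ->]|[-> ->]]; [left|right].
Qed.

Lemma adj_star (i j : 'I_n) :
  adj (star_graph n) i j = (i == 0 :> nat) && (0 < j) || (j == 0 :> nat) && (0 < i).
Proof.
apply/imsetP/orP => [[[a b]]|[ij|ij]]; last 2 first.
- by exists (i, j); rewrite ?inE.
- by exists (j, i); rewrite ?inE // setUC.
by rewrite inE => /= ab /set2_inj[[-> ->]|[-> ->]]; [left|right].
Qed.

(** The largest vertex of a cycle of length at least three would have two distinct smaller
    neighbours on it. *)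
Lemma acyclic_down (G : graph 'I_n) :
  (forall i j h : 'I_n, adj G i j -> adj G i h -> j < i -> h < i -> j = h) ->
  acyclic G.
Proof.
move=> down; apply/acyclicP => c /andP[cG uc].
case: c cG uc => // x0 c; set c0 := x0 :: c => cG uc.
have Px0 : x0 \in c0 by rewrite inE eqxx.
case: (@arg_maxnP _ x0 [in c0] (fun i : 'I_n => i) Px0) => x xc maxx.
have [i s es] := rot_to xc.
have mem_s y : y \in s -> y < x.
  move=> ys; have := uc; rewrite -(rot_uniq i) es /= => /andP[xs _].
  have /maxx : y \in c0 by rewrite -(mem_rot i) es inE ys orbT.
  rewrite /= leq_eqVlt => /predU1P[/val_inj e|//].
  by rewrite e (negPf xs) in ys.
move: uc cG; rewrite -(rot_uniq i) -(rot_cycle i) -(size_rot i) es.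
case: s {es} mem_s => [//|y s] mem_s /= /and3P[_ ys us].
rewrite rcons_path => /and3P[xy _ lx].
have e : y = last y s.
  apply: (down x) => //; first by rewrite adj_sym.
    by rewrite mem_s ?inE ?eqxx.
  by rewrite mem_s ?mem_last.
by case: s e ys {mem_s us lx} => // z s -> /=; rewrite mem_last.
Qed.

(** If [h] were missing, no edge could leave the part of [X] below [h], since adjacent vertices
    differ by one. *)
Lemma path_conn X : conn (path_graph n) X ->
  forall i j h : 'I_n, i \in X -> j \in X -> i <= h <= j -> h \in X.
Proof.
move=> /connP[_ _ cut] i j h iX jX /andP[ih hj]; apply: contraT => hX.
have neq (u : 'I_n) : u \in X -> u != h :> nat.
  by move=> uX; apply: contraNneq hX => /val_inj <-.
have [||a [b []]] := cut [set u in X | u < h].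
- apply/properP; split; first by apply/subsetP => u; rewrite inE => /andP[].
  by exists j; rewrite // inE jX -leqNgt.
- by apply/set0Pn; exists i; rewrite inE iX ltn_neqAle neq.
rewrite !inE => /andP[aX ah] bX; rewrite bX -leqNgt /= => hb.
by have := neq b bX; rewrite adj_path; lia.
Qed.

Lemma card_ord_interval a b : b <= n -> #|[set i : 'I_n | a <= i < b]| = b - a.
Proof.
move=> bn; rewrite -sum1dep_card.
rewrite -[RHS]muln1 -sum_nat_const_nat (big_nat_widen _ _ n) // big_geq_mkord.
by apply: eq_bigl => i; rewrite andbC.
Qed.

Lemma path_conn_card X (i j : 'I_n) : conn (path_graph n) X ->
  i \in X -> j \in X -> j - i < #|X|.
Proof.
move=> cX iX jX; have [ij|/ltnW] := leqP i j; last first.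
  rewrite -subn_eq0 => /eqP->; rewrite card_gt0; apply/set0Pn; by exists i.
rewrite -subSn // -card_ord_interval //; apply: subset_leq_card.
by apply/subsetP => h; rewrite inE ltnS; apply: path_conn.
Qed.

Hypothesis n_gt0 : 0 < n.

Lemma path_tree : is_tree (path_graph n).
Proof.
apply/andP; split; last first.
  apply: acyclic_down => i j h; rewrite !adj_path => ij ih ji hi.
  by apply: val_inj => /=; lia.
rewrite connected_conn.
suff H m (mn : m < n) : conn (path_graph n) [set i : 'I_n | i <= m].
  rewrite (_ : verts _ = [set i : 'I_n | i <= n.-1]) ?H ?prednK //.
  by apply/setP => i; rewrite !inE -ltnS prednK ?ltn_ord.
elim: m mn => [|m IH] mn.
  rewrite (_ : [set _ | _] = [set Ordinal mn]) ?conn1 ?inE //.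
  by apply/setP => i; rewrite !inE leqn0.
rewrite (_ : [set _ | _] = Ordinal mn |: [set i : 'I_n | i <= m]).
  apply: (@conn_add _ _ _ _ (Ordinal (ltnW mn))); first exact: IH (ltnW mn).
    by rewrite inE.
  by rewrite adj_path /= eqxx orbT.
by apply/setP => i; rewrite !inE leq_eqVlt.
Qed.

Let c0 := Ordinal n_gt0.

Lemma star_conn X : c0 \in X -> conn (star_graph n) X.
Proof.
move=> cX; apply/connP; split; first exact: subsetT.
  by apply/set0Pn; exists c0.
have adj0 (y : 'I_n) : y != c0 -> adj (star_graph n) c0 y.
  by rewrite adj_star /= lt0n => ->.
move=> Y YX /set0Pn[y yY]; have [cY|cY] := boolP (c0 \in Y).
  case/properP: YX => _ [z zX zY]; exists c0, z; split=> //.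
  by apply: adj0; apply: contraNneq zY => ->.
exists y, c0; split=> //; rewrite adj_sym adj0 //.
by apply: contraNneq cY => <-.
Qed.

Lemma star_tree : is_tree (star_graph n).
Proof.
apply/andP; split; first by rewrite connected_conn star_conn // inE.
apply: acyclic_down => i j h; rewrite !adj_star => ij ih ji hi.
by apply: val_inj => /=; lia.
Qed.

End PathStar.

(** * Trees compared with the star *)

Section Star.

Variables k l : nat.
Hypotheses (k_gt1 : 1 < k) (l_le_k : l <= k).

Lemma steiner_dist_ge (V : finType) (T : graph V) (S : {set V}) :
  is_tree T -> S \subset verts T -> #|S|.-1 <= steiner_dist T S.
Proof.
move=> tT ST; have /steiner_dist_leP := leqnn (steiner_dist T S).
case/(_ tT ST) => X [_ /subset_leq_card SX Xd].
by case: #|S| SX => // m SX; rewrite -ltnS (leq_trans SX).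
Qed.

Lemma steiner_dist_pred (V : finType) (T : graph V) (S : {set V}) : is_tree T ->
  S \subset verts T -> 0 < #|S| -> steiner_dist T S <= #|S|.-1 -> conn T S.
Proof.
move=> tT ST S0 /(steiner_dist_leP _ tT ST)[X [cX SX]]; rewrite prednK // => XS.
by have /eqP-> : S == X by rewrite eqEcard SX.
Qed.

(** Since [k - 1] is the least distance of a [k]-set, the sets counted are those whose [k]-supersets
    are all connected. The factor [0 < l] handles [l = 0], where no set qualifies although the
    truncated [l.-1] makes the binomial 1. *)
Lemma ecc_count_pred (V : finType) (T : graph V) : is_tree T -> k < #|verts T| ->
  ecc_count k l T k.-1 <= (0 < l) * 'C(#|verts T|.-1, l.-1).
Proof.
move=> tT kT; have cT := tree_conn tT; have aT : acyclic T by case/andP: tT.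
have k_gt0 := ltnW k_gt1.
move: l_le_k; rewrite leq_eqVlt => /predU1P[lk|lk].
  rewrite lk k_gt0 mul1n; apply: leq_trans (conn_acyclic_card aT cT k_gt1).
  apply: subset_leq_card; apply/subsetP => S; rewrite !inE.
  case/andP=> /andP[ST /eqP Sk] /steiner_ecc_leP/(_ S (subxx S) ST Sk) dS.
  by rewrite ST Sk eqxx steiner_dist_pred ?Sk.
have [|c [a [b [cV ab ca cb]]]] := conn_branch cT; first exact: leq_ltn_trans kT.
have aV : a \in verts T by rewrite adj_sym in ca; apply: adj_verts ca.
have bV : b \in verts T by rewrite adj_sym in cb; apply: adj_verts cb.
have sub (S : {set V}) : S \subset verts T -> #|S| = l -> steiner_ecc k T S <= k.-1 ->
    c \in S.
  move=> ST Sl eS; apply: contraT => cS.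
  (* As [k < #|verts T|], [A] can be enlarged to a [k]-set without using [c]; being a superset of
     [S], this [k]-set is connected. *)
  have ext (A : {set V}) : S \subset A -> A \subset verts T :\ c -> #|A| <= k ->
      exists X, [/\ conn T X, A \subset X & c \notin X].
    move=> SA AT Ak; have kTc : k <= #|verts T :\ c|.
      by have := cardsD1 c (verts T); rewrite cV add1n => e; rewrite -ltnS -e.
    have [|X [AX XT Xk]] := @set_between _ A _ k AT; first by rewrite Ak.
    move: XT; rewrite subsetD1 => /andP[XT cX]; exists X; split=> //.
    apply: steiner_dist_pred; rewrite ?Xk //.
    by move/steiner_ecc_leP: eS; apply=> //; apply: subset_trans AX.
  have STc : S \subset verts T :\ c by rewrite subsetD1 ST.
  have inTc z : z \in verts T -> adj T c z -> [set z] \subset verts T :\ c.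
    by move=> zV cz; rewrite sub1set !inE zV eq_sym (adj_neq cz).
  have Sz z : #|z |: S| <= k by rewrite cardsU1 Sl (leq_trans _ lk) // -add1n leq_add2r leq_b1.
  (* If [S] is empty, [k >= 2] leaves room for both [a] and [b]. Otherwise [l < k] guarantees room
     for only one of them, and two connected sets are glued at an element of [S]. *)
  have [X [cX abX cX']] : exists X, [/\ conn T X, [set a; b] \subset X & c \notin X].
    have [S0|[s sS]] := set_0Vmem S.
      apply: ext; rewrite ?S0 ?sub0set ?cards2 ?ab //.
      by rewrite subUset !inTc.
    have [|||X [cX aX cX']] := ext (a |: S); rewrite ?subsetUr ?subUset ?inTc //.
    have [|||Y [cY bY cY']] := ext (b |: S); rewrite ?subsetUr ?subUset ?inTc //.
    move: aX bY; rewrite !subUset !sub1set => /andP[aX SX] /andP[bY SY].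
    exists (X :|: Y); split; last by rewrite inE negb_or cX'.
      apply: connU => //; apply/set0Pn; exists s.
      by rewrite inE (subsetP SX) ?(subsetP SY).
    by rewrite subUset !sub1set !inE aX bY orbT.
  move: abX; rewrite subUset !sub1set => /andP[aX bX].
  by rewrite (acyclic_nbr_inj aT cX cX' aX bX ca cb) eqxx in ab.
apply: (@leq_trans #|[set S : {set V} | [&& [set c] \subset S, S \subset verts T & #|S| == l]]|).
  apply: subset_leq_card; apply/subsetP => S; rewrite !inE.
  by case/andP=> /andP[ST /eqP Sl] /(sub S ST Sl) cS; rewrite sub1set cS ST Sl eqxx.
case: posnP => [l0|l0].
  rewrite leqn0 cards_eq0; apply/eqP/setP => S; rewrite !inE l0.
  apply/and3P => -[+ _]; rewrite cards_eq0 => /[swap] /eqP->.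
  by rewrite sub1set inE.
by rewrite card_between ?sub1set ?cards1 // !subn1 mul1n.
Qed.

Lemma ecc_count_star n (V : finType) (T : graph V) t :
  is_tree T -> #|verts T| = n -> k < n ->
  ecc_count k l T t <= ecc_count k l (star_graph n) t.
Proof.
move=> tT eT kn; have n0 : 0 < n by apply: leq_ltn_trans kn.
have tS := star_tree n0; have vS : #|verts (star_graph n)| = n by rewrite cardsT card_ord.
have dS (S : {set 'I_n}) : steiner_dist (star_graph n) S <= #|Ordinal n0 |: S|.-1.
  apply/(steiner_dist_leP _ tS (subsetT _)); exists (Ordinal n0 |: S).
  by rewrite subsetUr leqSpred star_conn ?setU11.
(* A [k]-set of the star has distance [k - 1] or [k], so for [t >= k] the star counts every [l]-set;
   for [t < k - 1] no tree counts any. *)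
have [kt|tk] := leqP k t.
  rewrite (@ecc_count_full _ _ _ (star_graph n)) => [|S _ Sk].
    by rewrite vS -eT ecc_count_le.
  apply: leq_trans (dS S) _; apply: leq_trans kt; rewrite cardsU1 Sk.
  by case: (_ \notin _); rewrite //= leq_pred.
have : t <= k.-1 by rewrite -ltnS (ltn_predK tk).
rewrite leq_eqVlt => /predU1P[->|tk1]; last first.
  rewrite (_ : ecc_count k l T t = 0) //; apply/eqP; rewrite cards_eq0.
  apply/eqP/setP => S; rewrite !inE; apply/negP => /andP[/andP[ST /eqP Sl]].
  have [|S' [SS' S'T S'k]] := @set_between _ S _ k ST; first by rewrite Sl eT l_le_k ltnW.
  move/steiner_ecc_leP/(_ S' SS' S'T S'k); rewrite leqNgt (leq_trans tk1) //.
  by rewrite -{1}S'k steiner_dist_ge.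
apply: leq_trans (ecc_count_pred tT _) _; rewrite eT //.
case: posnP => // l0; rewrite mul1n.
have -> : 'C(n.-1, l.-1) =
    #|[set S : {set 'I_n} | [&& [set Ordinal n0] \subset S, S \subset [set: 'I_n] & #|S| == l]]|.
  by rewrite card_between ?sub1set ?inE ?cards1 // cardsT card_ord !subn1.
apply: subset_leq_card; apply/subsetP => S; rewrite !inE sub1set => /and3P[cS -> ->] /=.
apply/steiner_ecc_leP => S' SS' _ S'k; apply: leq_trans (dS S') _.
by rewrite (setUidPr _) ?S'k ?sub1set ?(subsetP SS').
Qed.

End Star.

(** * Trees compared with the path *)

Section Path.

Lemma path_steiner_dist_ge n (S : {set 'I_n}) (i j : 'I_n) :
  i \in S -> j \in S -> j - i <= steiner_dist (path_graph n) S.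
Proof.
move=> iS jS; have tP : is_tree (path_graph n) by apply/path_tree/leq_ltn_trans/(ltn_ord i).
have /(steiner_dist_leP _ tP (subsetT _)) [X [cX SX Xd]] := leqnn (steiner_dist (path_graph n) S).
by rewrite -ltnS (leq_trans _ Xd) // path_conn_card ?(subsetP SX).
Qed.

(** These are the [k]-sets of diameter at most [t] among the first [m] vertices of the path. [n]
    stays fixed while [m] decreases in an induction; truncated subtraction makes the pair in the
    wrong order harmless. *)
Definition window n m k t (S : {set 'I_n}) : bool :=
  [&& S \subset [set i : 'I_n | i < m], #|S| == k &
   [forall i in S, forall j in S, j - i <= t]].

(** The peeled vertex [w] is matched with the last vertex of the path. Windows through the last
    vertex lie in the last [t + 1] vertices; on the tree side a connected set of [t + 1] vertices
    through [w] provides as many sets. *)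
Lemma card_windows_le n (V : finType) (T : graph V) (W : {set V}) k t :
  is_tree T -> 0 < k -> conn T W -> #|W| <= n ->
  #|[set S : {set 'I_n} | window #|W| k t S]| <=
  #|[set S : {set V} | [&& S \subset W, #|S| == k & steiner_dist T S <= t]]|.
Proof.
move=> tT k0; elim: {W}#|W|.+1 {-2}W (ltnSn #|W|) => // m IH W Wm cW Wn.
have [WT /set0Pn[u uW] _] := connP _ _ cW.
have [W1|W1] := leqP #|W| t.+1.
  apply: (@leq_trans 'C(#|W|, k)).
    rewrite -[X in 'C(X, _)]subn0 -(card_ord_interval _ Wn) -cards_draws.
    apply: subset_leq_card; apply/subsetP => S; rewrite !inE => /and3P[SI -> _].
    by rewrite andbT.
  rewrite -cards_draws; apply: subset_leq_card; apply/subsetP => S; rewrite !inE.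
  case/andP=> SW ->; rewrite SW /=; apply/steiner_dist_leP => //.
    exact: subset_trans SW WT.
  by exists W.
have [w [wW wu cWw]] := conn_peel cW uW (leq_ltn_trans (ltn0Sn t) W1).
have := cardsD1 w W; rewrite wW add1n => eW.
have [|X [cX wX XW Xt]] := @conn_shrink _ _ _ w t.+1 cW wW; first exact: ltnW.
have Ww_lt : #|W :\ w| < m by rewrite eW in Wm.
have Ww_n : #|W :\ w| <= n by rewrite ltnW // -eW.
have IHw := IH _ Ww_lt cWw Ww_n.
apply: (@leq_trans (#|[set S : {set 'I_n} | window #|W :\ w| k t S]| + 'C(t, k.-1))).
  have lt : #|W :\ w| < n by rewrite -eW.
  (* [x] is the last of the first [#|W|] vertices and [I] consists of the last [t + 1] of these. *)
  pose x := Ordinal lt; pose I := [set i : 'I_n | #|W :\ w| - t <= i < #|W|].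
  have xI : [set x] \subset I by rewrite sub1set inE /= leq_subr eW ltnS leqnn.
  have eI : #|I| = t.+1.
    by rewrite card_ord_interval // eW subSn ?leq_subr // subKn // -ltnS -eW ltnW.
  have -> : 'C(t, k.-1) =
      #|[set S : {set 'I_n} | [&& [set x] \subset S, S \subset I & #|S| == k]]|.
    by rewrite card_between ?cards1 // eI !subn1.
  apply: leq_trans (leq_card_setU _ _); apply: subset_leq_card; apply/subsetP => S.
  rewrite !inE sub1set => /and3P[SW Sk St]; rewrite /window Sk St !andbT.
  have [xS|xS] := boolP (x \in S); apply/orP; [right|left].
    apply/subsetP => i iS; rewrite inE; have := subsetP SW _ iS; rewrite inE => ->.
    move/forall_inP/(_ i iS)/forall_inP/(_ x xS): St => /=.
    by rewrite andbT leq_subLR addnC -leq_subLR.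
  apply/subsetP => i iS; have := subsetP SW _ iS.
  rewrite !inE eW ltnS leq_eqVlt => /predU1P[e|//].
  by case/negP: xS; rewrite (_ : x = i) //; apply: val_inj.
have -> : 'C(t, k.-1) =
    #|[set S : {set V} | [&& [set w] \subset S, S \subset X & #|S| == k]]|.
  by rewrite card_between ?sub1set ?cards1 // Xt !subn1.
apply: (leq_trans (leq_add IHw (leqnn _))).
(* The two families are disjoint: the first avoids [w], the second contains it. *)
rewrite -cardsUI [X in _ + #|pred_of_set X|](_ : _ = set0) ?cards0 ?addn0; last first.
  apply/setP => S; rewrite !inE sub1set subsetD1.
  by case: (w \in S); rewrite ?andbF.
apply: subset_leq_card; apply/subsetP => S; rewrite !inE sub1set.
case/orP=> /and3P[].
  by rewrite subsetD1 => /andP[-> _] -> ->.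
move=> wS SX ->; rewrite (subset_trans SX XW) /=; apply/steiner_dist_leP => //.
  by apply: subset_trans WT; apply: subset_trans XW.
by exists X; rewrite Xt.
Qed.

Lemma ecc_count_path k l n (V : finType) (T : graph V) t :
  1 < k -> l <= k -> is_tree T -> #|verts T| = n -> k < n ->
  ecc_count k l (path_graph n) t <= ecc_count k l T t.
Proof.
move=> k1 lk tT eT kn; have cT := tree_conn tT.
have n0 : 0 < n by apply: leq_ltn_trans kn.
have vP : #|verts (path_graph n)| = n by rewrite cardsT card_ord.
have [nt|tn] := leqP n.-1 t.
  rewrite (@ecc_count_full _ _ _ T) => [|S ST _]; first by rewrite eT (leq_trans (ecc_count_le _ _ _ _)) ?vP.
  apply/steiner_dist_leP => //; exists (verts T); split=> //.
  by rewrite eT -(prednK n0) ltnS.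
have tn1 : t.+1 < n by rewrite -ltn_predRL.
have ln : n.-1 < n by rewrite prednK.
pose p0 := Ordinal n0; pose p1 := Ordinal ln.
(* If [i] and [j] fit into a [k]-superset of [S], that superset has distance at least [j - i]. *)
have ecc_ge (S : {set 'I_n}) (i j : 'I_n) : #|i |: (j |: S)| <= k ->
    steiner_ecc k (path_graph n) S <= t -> j - i <= t.
  move=> Sk /steiner_ecc_leP H.
  have [|S' [iS' _ S'k]] := @set_between _ (i |: (j |: S)) [set: 'I_n] k (subsetT _).
    by rewrite Sk cardsT card_ord ltnW.
  have SS' : S \subset S' by apply: subset_trans iS'; rewrite setUA subsetUr.
  apply: leq_trans (H S' SS' (subsetT _) S'k).
  by apply: path_steiner_dist_ge; rewrite (subsetP iS') // !inE eqxx ?orbT.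
case: (ltngtP l k) lk => // [lk _|lk _].
  case: (ltngtP l.+1 k) lk => // [lk _|lk _].
    rewrite (_ : ecc_count _ _ _ _ = 0) //; apply/eqP; rewrite cards_eq0.
    apply/eqP/setP => S; rewrite !inE; apply/negP => /andP[/andP[_ /eqP Sl]].
    have Sk : #|p0 |: (p1 |: S)| <= k.
      by rewrite !cardsU1 Sl; do 2!case: (_ \notin _); lia.
    by move/(ecc_ge S p0 p1 Sk); rewrite /= subn0 leqNgt tn.
  have l0 : 0 < l by rewrite -ltnS lk.
  (* [j] is chosen so that [t = n - 1 - j]. With room for one extra vertex, adding either end of the
     path shows that a counted set lies between [j] and [t]. *)
  pose j := n - t.+1.
  apply: (@leq_trans 'C(t.+1 - j, l)).
    rewrite -(card_ord_interval j (ltnW tn1)) -cards_draws; apply: subset_leq_card.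
    apply/subsetP => S; rewrite !inE => /andP[/andP[_ Sl] eS]; rewrite Sl andbT.
    have ge x y z : z \in S -> (x == z) || (y == z) -> y - x <= t.
      move=> zS xyz; apply: (ecc_ge S) => //.
      rewrite !cardsU1 (eqP Sl) -lk in_setU1.
      by case/orP: xyz => /eqP->; rewrite zS ?orbT /= add0n -[l.+1]add1n leq_add2r leq_b1.
    apply/subsetP => i iS; rewrite inE ltnS.
    have := ge p0 i i iS; rewrite eqxx orbT /= subn0 => -> //; rewrite andbT.
    by have := ge i p1 i iS; rewrite eqxx /= => /(_ isT); lia.
  (* Here the interval is empty, and [l > 0] makes the count zero. *)
  have [jj|jj] := leqP (t.+1) j.
    by rewrite (eqP (_ : t.+1 - j == 0)) ?subn_eq0 // bin0n (gtn_eqF l0).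
  have jn : j.*2 < #|verts T| by rewrite eT; lia.
  have jt : n - j.*2 + j <= t.+1 by lia.
  have [M [cM MT eM rM]] := conn_peel_layers cT jn.
  have -> : t.+1 - j = #|M| by rewrite eM eT; lia.
  rewrite -cards_draws; apply: subset_leq_card; apply/subsetP => S; rewrite !inE.
  case/andP=> SM /eqP Sl; rewrite (subset_trans SM MT) Sl eqxx /=.
  apply/steiner_ecc_leP => S' SS' S'T S'k.
  (* [S'] has one vertex [x] outside [S]. Joining [x] to [M] costs at most [j] vertices, for a total
     of at most [(n - 2j) + j = t + 1]. *)
  have /cards1P[x ex] : #|S' :\: S| == 1.
    by rewrite cardsD (setIidPr SS') S'k Sl -lk subSnn.
  have xS' : x \in S' :\: S by rewrite ex set11.
  have xT : x \in verts T by move: xS'; rewrite inE => /andP[_ /(subsetP S'T)].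
  have [p [xp pM pj]] := rM x xT.
  have [X [cX MX xX eX]] := conn_path cM xp pM.
  apply/steiner_dist_leP => //; exists X; split=> //.
    by rewrite -(setID S' S) ex subUset sub1set xX (setIidPr SS') (subset_trans SM) ?andbT.
  apply: leq_trans eX _; rewrite eM eT; apply: leq_trans jt.
  by rewrite leq_add2l.
(* A [k]-set is its own only [k]-superset, so its eccentricity is its distance. *)
rewrite lk; have k0 := ltnW k1.
apply: (@leq_trans #|[set S : {set 'I_n} | window #|verts T| k t S]|).
  apply: subset_leq_card; apply/subsetP => S; rewrite !inE => /andP[/andP[_ Sk] eS].
  rewrite /window Sk; apply/andP; split.
    by apply/subsetP => i _; rewrite inE eT.
  apply/forall_inP => i iS; apply/forall_inP => j jS; apply: (ecc_ge S) => //.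
  by rewrite (setUidPr _) ?(setUidPr _) ?sub1set // ?inE ?iS ?orbT // (eqP Sk).
apply: leq_trans (card_windows_le t tT k0 cT _) _; rewrite ?eT //.
apply: subset_leq_card; apply/subsetP => S; rewrite !inE => /and3P[-> Sk dS].
rewrite Sk; apply/steiner_ecc_leP => S' SS' _ S'k.
by have /eqP<- : S == S' by rewrite eqEcard SS' S'k (eqP Sk) leqnn.
Qed.

End Path.

Theorem theorem4 (k l n : nat) (hk : 2 <= k) (hl : l <= k) (hn : k + 1 <= n) :
  (forall (V : finType) (T : graph V), is_tree T -> #|verts T| = n ->
     (avg_steiner_ecc k l (star_graph n) <= avg_steiner_ecc k l T)%R /\
     (avg_steiner_ecc k l T <= avg_steiner_ecc k l (path_graph n))%R) /\
  (exists T : graph 'I_n,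
     [/\ is_tree T, #|verts T| = n
       & avg_steiner_ecc k l T = avg_steiner_ecc k l (star_graph n)]) /\
  (exists T : graph 'I_n,
     [/\ is_tree T, #|verts T| = n
       & avg_steiner_ecc k l T = avg_steiner_ecc k l (path_graph n)]).
Proof.
have k1n : k < n by rewrite -addn1.
have n0 : 0 < n by apply: leq_ltn_trans k1n.
have vn (G : graph 'I_n) : verts G = [set: 'I_n] -> #|verts G| = n.
  by move->; rewrite cardsT card_ord.
split=> [V T tT eT|]; last split.
- split; apply: leq_avg_steiner_ecc; rewrite ?eT ?vn // => t.
    exact: ecc_count_star.
  exact: ecc_count_path.
- by exists (star_graph n); rewrite star_tree // vn.
- by exists (path_graph n); rewrite path_tree // vn.
Qed.
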